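(* Let $n\ge 1$, $\eta>0$, and let $t\mapsto C(t)$ be a set-valued map assigning to each $t\in\mathbb{R}$ a nonempty closed $\eta$-prox-regular set $C(t)\subset\mathbb{R}^n$, which is Lipschitz continuous with constant $L_C\ge 0$, i.e. $d_H(C(t_1),C(t_2))\le L_C|t_1-t_2|$ for all $t_1,t_2\in\mathbb{R}$. Let $f:\mathbb{R}\times\mathbb{R}^n\to\mathbb{R}^n$ satisfy, for some $L_f>0$, $$\|f(t_1,x_1)-f(t_2,x_2)\|\le L_f|t_1-t_2|+L_f\|x_1-x_2\|\quad\text{for all } t_1,t_2\in\mathbb{R},\ x_1,x_2\in\mathbb{R}^n.$$ Assume that there is a constant $M_f\ge 0$ such that $$\|f(t,x)\|\le M_f\quad\text{for all } t\in\mathbb{R},\ x\in\bigcup_{s\in\mathbb{R}}C(s),$$ and that there is a constant $\alpha>0$ such that $$\langle f(t,x_1)-f(t,x_2),x_1-x_2\rangle\ge\alpha\|x_1-x_2\|^2\quad\text{for all } t\in\mathbb{R},\ x_1,x_2\in\mathbb{R}^n,$$ with $$\alpha>\frac{L_C+M_f}{\eta}.$$ Then the sweeping process $$-\dot x\in N(C(t),x)+f(t,x)$$ has a unique solution $x_0$ defined on all of $\mathbb{R}$. Furthermore, $x_0$ is globally exponentially stable.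
   Context: Norms and inner products are Euclidean. For a closed set $C\subset\mathbb{R}^n$, $\mathrm{proj}(y,C)$ is the set of points of $C$ closest to $y$. For $x\in C$ the (proximal) normal cone is $N(C,x)=\{v\in\mathbb{R}^n:\ x\in\mathrm{proj}(x+av,C)\text{ for some }a>0\}$. For $\eta>0$, a closed set $C$ is $\eta$-prox-regular if it admits external tangent balls of radius $\eta$ at its boundary points: for every $x\in\partial C$ and every nonzero $v\in N(C,x)$, the open ball of radius $\eta$ centered at $x+\eta v/\|v\|$ does not intersect $C$. The Hausdorff distance is $d_H(C_1,C_2)=\max\{\sup_{x\in C_2}\mathrm{dist}(x,C_1),\ \sup_{x\in C_1}\mathrm{dist}(x,C_2)\}$, where $\mathrm{dist}(x,C)=\inf\{\|x-c\|:c\in C\}$. A solution of the sweeping process on an interval $I\subset\mathbb{R}$ is a function $x:I\to\mathbb{R}^n$, absolutely continuous (on compact subintervals of $I$), such that $x(t)\in C(t)$ for all $t\in I$ and $-\dot x(t)\in N(C(t),x(t))+f(t,x(t))$ for a.e. $t\in I$. A solution $x_0$ defined on $\mathbb{R}$ is globally exponentially stable if there exist constants $K\ge 1$, $c>0$ such that for every $\tau\in\mathbb{R}$ and every solution $x$ on $[\tau,\infty)$ one has $\|x(t)-x_0(t)\|\le Ke^{-c(t-\tau)}\|x(\tau)-x_0(\tau)\|$ for all $t\ge\tau$. *)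

(* Defs.v *)
From HB Require Import structures.
From mathcomp Require Import all_boot all_order all_algebra.
From mathcomp Require Import all_classical all_reals all_analysis.

Set Implicit Arguments.
Unset Strict Implicit.
Unset Printing Implicit Defensive.

Import Order.TTheory GRing.Theory Num.Theory.
Import numFieldNormedType.Exports.

Local Open Scope classical_set_scope.
Local Open Scope ring_scope.

Definition dotr (R : realType) (n : nat) (u v : 'rV[R]_n) : R :=
  \sum_(i < n) u ord0 i * v ord0 i.

(* The library norm `|v| on 'rV[R]_n is the sup norm; it induces the same
   topology (closed, closure, interior, derivative) as this one. *)
Definition enorm (R : realType) (n : nat) (v : 'rV[R]_n) : R :=
  Num.sqrt (dotr v v).

Definition eball (R : realType) (n : nat) (c : 'rV[R]_n) (r : R) :
    set 'rV[R]_n :=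
  [set z | enorm (z - c) < r].

Definition proj (R : realType) (n : nat) (y : 'rV[R]_n) (C : set 'rV[R]_n) :
    set 'rV[R]_n :=
  [set x | C x /\ forall c, C c -> enorm (y - x) <= enorm (y - c)].

Definition normal_cone (R : realType) (n : nat) (C : set 'rV[R]_n)
    (x : 'rV[R]_n) : set 'rV[R]_n :=
  [set v | exists2 a : R, 0 < a & proj (x + a *: v) C x].

Definition frontier (R : realType) (n : nat) (C : set 'rV[R]_n) :
    set 'rV[R]_n :=
  closure C `\` interior C.

Definition prox_regular (R : realType) (n : nat) (eta : R)
    (C : set 'rV[R]_n) : Prop :=
  forall x v : 'rV[R]_n, frontier C x -> normal_cone C x v -> v != 0 ->
    eball (x + (eta / enorm v) *: v) eta `&` C = set0.

Definition set_dist (R : realType) (n : nat) (x : 'rV[R]_n)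
    (C : set 'rV[R]_n) : \bar R :=
  ereal_inf [set (enorm (x - c))%:E | c in C].

Definition hausdorff_dist (R : realType) (n : nat)
    (C1 C2 : set 'rV[R]_n) : \bar R :=
  maxe (ereal_sup [set set_dist x C1 | x in C2])
       (ereal_sup [set set_dist x C2 | x in C1]).

Definition abs_continuous (R : realType) (n : nat) (a b : R)
    (x : R -> 'rV[R]_n) : Prop :=
  forall eps : R, 0 < eps -> exists2 delta : R, 0 < delta &
    forall (m : nat) (u v : 'I_m -> R),
      (forall i, a <= u i /\ u i <= v i /\ v i <= b) ->
      trivIset setT (fun i => `]u i, v i[%classic) ->
      \sum_(i < m) (v i - u i) < delta ->
      \sum_(i < m) enorm (x (v i) - x (u i)) < eps.

(* x is a total function whose values outside I are irrelevant: the two-sided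
   derivative at an interior point of I only depends on x restricted to I, and
   the endpoints of I form a null set. *)
Definition sweeping_solution (R : realType) (n : nat)
    (C : R -> set 'rV[R]_n) (f : R -> 'rV[R]_n -> 'rV[R]_n)
    (I : interval R) (x : R -> 'rV[R]_n) : Prop :=
  [/\ forall a b : R, a <= b -> `[a, b] `<=` [set` I] -> abs_continuous a b x,
      forall t, t \in I -> C t (x t)
    & {ae (@lebesgue_measure R), forall t, t \in I ->
        derivable x t 1 /\
        [set w + f t (x t) | w in normal_cone (C t) (x t)] (- 'D_1 x t)}].

Definition globally_exp_stable (R : realType) (n : nat)
    (C : R -> set 'rV[R]_n) (f : R -> 'rV[R]_n -> 'rV[R]_n)
    (x0 : R -> 'rV[R]_n) : Prop :=
  exists K c : R, [/\ 1 <= K, 0 < c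
    & forall (tau : R) (x : R -> 'rV[R]_n),
        sweeping_solution C f `[tau, +oo[ x ->
        forall t, tau <= t ->
          enorm (x t - x0 t)
            <= K * expR (- c * (t - tau)) * enorm (x tau - x0 tau)].

(* Main.v *)
(* Write M = LC + Mf.

   Boundedness: strong monotonicity together with the bound Mf on f forces the
   union of all C t to have diameter at most 2 Mf / alpha.

   Stability: comparing x (t - h), which is LC * h-close to C t, with x t shows
   that at almost every t the normal part w of the velocity of a solution
   satisfies |w| <= M. Prox-regularity turns a normal w into the inequality
   <w, c - x> <= |w| / (2 eta) |c - x|^2 on C t, so for two solutions
   d/dt |x1 - x2|^2 <= - 2 (alpha - M / eta) |x1 - x2|^2 almost everywhere, and
   the distance decays exponentially on every interval on which both solutions
   exist. Two solutions on the whole line are at bounded distance, and letting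
   the initial time go to -oo shows that they agree.

   Existence: run the catching-up scheme X_(k+1) = proj (X_k - h f, C) with
   mesh h = 1 / (N + 1) from time - N, and take the pointwise limit x of these
   approximations along an ultrafilter on N. No uniform or weak convergence is
   needed: summing the discrete normal inequalities over a window [t, t + d],
   against a fixed c in C t, the increments of X telescope, so the inequality
     <x t - x (t + d), c - x t> - d <f t (x t), c - x t>
       <= d (M / (2 eta) |c - x t|^2 + K d)
   only involves values at t and t + d and survives the pointwise limit.
   Dividing by d at a point of differentiability of the Lipschitz function x
   gives <- x' - f, c - x> <= M / (2 eta) |c - x|^2 for all c in C t, which
   characterizes - x' - f as a proximal normal. *)

Require Import Defs.
From HB Require Import structures.
From mathcomp Require Import all_boot all_order all_algebra.
From mathcomp Require Import all_classical all_reals all_analysis.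
From mathcomp Require Import ring lra.

Import Order.TTheory GRing.Theory Num.Theory.
Import numFieldNormedType.Exports.

Local Open Scope classical_set_scope.
Local Open Scope ring_scope.

Set Implicit Arguments.
Unset Strict Implicit.
Unset Printing Implicit Defensive.

(** * Euclidean norm and inner product *)

Section Euclidean.
Context {R : realType} {n : nat}.
Implicit Types (u v w : 'rV[R]_n) (a : R).

Lemma dotrC u v : dotr u v = dotr v u.
Proof. by apply: eq_bigr => i _; rewrite mulrC. Qed.

Lemma dotrDl u v w : dotr (u + v) w = dotr u w + dotr v w.
Proof. by rewrite -big_split; apply: eq_bigr => i _; rewrite !mxE mulrDl. Qed.

Lemma dotrDr u v w : dotr w (u + v) = dotr w u + dotr w v.
Proof. by rewrite !(dotrC w) dotrDl. Qed.

Lemma dotrZl a u v : dotr (a *: u) v = a * dotr u v.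
Proof. by rewrite mulr_sumr; apply: eq_bigr => i _; rewrite !mxE mulrA. Qed.

Lemma dotrZr a u v : dotr u (a *: v) = a * dotr u v.
Proof. by rewrite !(dotrC u) dotrZl. Qed.

Lemma dotrNl u v : dotr (- u) v = - dotr u v.
Proof. by rewrite -scaleN1r dotrZl mulN1r. Qed.

Lemma dotrNr u v : dotr u (- v) = - dotr u v.
Proof. by rewrite -scaleN1r dotrZr mulN1r. Qed.

Lemma dotrBl u v w : dotr (u - v) w = dotr u w - dotr v w.
Proof. by rewrite dotrDl dotrNl. Qed.

Lemma dotrBr u v w : dotr w (u - v) = dotr w u - dotr w v.
Proof. by rewrite dotrDr dotrNr. Qed.

Lemma dotr0 u : dotr u 0 = 0.
Proof. by rewrite -(scale0r 0) dotrZr mul0r. Qed.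

Lemma dot0r u : dotr 0 u = 0.
Proof. by rewrite dotrC dotr0. Qed.

Lemma dotrr_ge0 u : 0 <= dotr u u.
Proof. by apply: sumr_ge0 => i _; rewrite -expr2 sqr_ge0. Qed.

Lemma enorm_ge0 u : 0 <= enorm u.
Proof. exact: sqrtr_ge0. Qed.

Lemma sqr_enorm u : enorm u ^+ 2 = dotr u u.
Proof. by rewrite sqr_sqrtr // dotrr_ge0. Qed.

Lemma enorm_eq0 u : (enorm u == 0) = (u == 0).
Proof.
apply/eqP/eqP => [u0|->]; last by rewrite /enorm dotr0 sqrtr0.
have /eqP : dotr u u = 0 by rewrite -sqr_enorm u0 expr0n.
rewrite psumr_eq0 => [/allP u_eq0|i _]; last by rewrite -expr2 sqr_ge0.
apply/rowP => i; have := u_eq0 i (mem_index_enum _).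
by rewrite /= mulf_eq0 orbb mxE => /eqP.
Qed.

Lemma enorm0 : enorm (0 : 'rV[R]_n) = 0.
Proof. by apply/eqP; rewrite enorm_eq0. Qed.

Lemma enorm_gt0 u : (0 < enorm u) = (u != 0).
Proof. by rewrite lt_neqAle enorm_ge0 andbT eq_sym enorm_eq0. Qed.

Lemma enormN u : enorm (- u) = enorm u.
Proof. by rewrite /enorm dotrNl dotrNr opprK. Qed.

Lemma enormB u v : enorm (u - v) = enorm (v - u).
Proof. by rewrite -enormN opprB. Qed.

Lemma enormZ a u : enorm (a *: u) = `|a| * enorm u.
Proof.
by rewrite /enorm dotrZl dotrZr mulrA -expr2 sqrtrM ?sqr_ge0// sqrtr_sqr.
Qed.

(** Cauchy-Schwarz: expand the nonnegative square of [enorm v *: u - enorm u *: v] and cancel the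
    positive factor [enorm u * enorm v]. *)
Lemma dotr_le u v : dotr u v <= enorm u * enorm v.
Proof.
have [->|u0] := eqVneq u 0; first by rewrite dot0r enorm0 mul0r.
have [->|v0] := eqVneq v 0; first by rewrite dotr0 enorm0 mulr0.
have := dotrr_ge0 (enorm v *: u - enorm u *: v).
rewrite dotrBl !dotrBr !dotrZl !dotrZr (dotrC v u) -!sqr_enorm.
have : 0 < enorm u * enorm v by rewrite mulr_gt0 ?enorm_gt0.
move: (enorm u) (enorm v) (dotr u v) => p q d pq_gt0 h.
rewrite -(ler_pM2l pq_gt0); lra.
Qed.

Lemma ler_norm_dotr u v : `|dotr u v| <= enorm u * enorm v.
Proof.
by rewrite ler_norml dotr_le andbT lerNl -dotrNl (le_trans (dotr_le _ _))// enormN.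
Qed.

Lemma ler_enormD u v : enorm (u + v) <= enorm u + enorm v.
Proof.
rewrite -[leLHS]ger0_norm ?enorm_ge0// -[leRHS]ger0_norm ?addr_ge0 ?enorm_ge0//.
rewrite -ler_sqr ?nnegrE// !real_normK ?num_real// sqr_enorm sqrrD.
rewrite dotrDl !dotrDr (dotrC v u) -!sqr_enorm.
by have := dotr_le u v; lra.
Qed.

Lemma ler_enormB u v : enorm (u - v) <= enorm u + enorm v.
Proof. by rewrite (le_trans (ler_enormD _ _))// enormN. Qed.

Lemma ler_enorm_distD w u v : enorm (u - v) <= enorm (u - w) + enorm (w - v).
Proof. by rewrite (le_trans _ (ler_enormD _ _))// addrA subrK. Qed.

Lemma enorm_sqrD u v :
  enorm (u + v) ^+ 2 = enorm u ^+ 2 + 2 * dotr u v + enorm v ^+ 2.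
Proof. by rewrite !sqr_enorm dotrDl !dotrDr (dotrC v u); ring. Qed.

Lemma enorm_sqrB u v :
  enorm (u - v) ^+ 2 = enorm u ^+ 2 - 2 * dotr u v + enorm v ^+ 2.
Proof. by rewrite enorm_sqrD dotrNr enormN; ring. Qed.

Lemma coord_le_enorm u i : `|u ord0 i| <= enorm u.
Proof.
rewrite -(@ler_pXn2r _ 2) ?nnegrE ?enorm_ge0// sqr_enorm real_normK ?num_real//.
rewrite /dotr (bigD1 i)//= expr2 lerDl.
by apply: sumr_ge0 => j _; rewrite -expr2 sqr_ge0.
Qed.

Lemma norm_le_enorm u : `|u| <= enorm u.
Proof.
rewrite [leLHS]/Num.Def.normr/= mx_normrE (bigmax_le _ (enorm_ge0 _))//=.
by move=> [i j] _ /=; rewrite ord1; exact: coord_le_enorm.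
Qed.

Section limits.
Context {T : Type} {F : set_system T} {FF : Filter F}.
Implicit Types (p q : T -> 'rV[R]_n).

Lemma cvg_coord p u i : p @ F --> u -> (fun t => p t ord0 i) @ F --> u ord0 i.
Proof.
move=> pu.
exact: (cvg_comp p (fun w => w ord0 i) pu (@coord_continuous _ _ _ ord0 i u)).
Qed.

Lemma cvg_dotr p q u v :
  p @ F --> u -> q @ F --> v -> (fun t => dotr (p t) (q t)) @ F --> dotr u v.
Proof.
move=> pu qv; apply: cvg_big => [|i _]; first exact: add_continuous.
by apply: cvgM; exact: cvg_coord.
Qed.

Lemma cvg_enorm p u : p @ F --> u -> (fun t => enorm (p t)) @ F --> enorm u.
Proof.
move=> pu.
exact: (cvg_comp _ _ (cvg_dotr pu pu) (@sqrt_continuous R (dotr u u))).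
Qed.

End limits.
End Euclidean.

(** * Absolute continuity and differentiability almost everywhere *)

Section absolutely_continuous.
Context {R : realType}.
Notation mu := (@lebesgue_measure R).

(* Nonoverlapping intervals in [a, b], listed from right to left. *)
Definition chain (a b : R) (s : seq (R * R)) :=
  all (fun p => [&& a <= p.1, p.1 <= p.2 & p.2 <= b]) s
  && pairwise (fun p q => q.2 <= p.1) s.

(** Lists can be extended by one interval at a time, which suits real induction; their ordering
    yields the disjointness asked by [abs_continuous]. *)
Lemma abs_continuous_chain n (x : R -> 'rV[R]_n) (a b e : R) :
  abs_continuous a b x -> 0 < e -> exists2 d, 0 < d & forall s, chain a b s ->
    \sum_(p <- s) (p.2 - p.1) < d ->
    \sum_(p <- s) enorm (x p.2 - x p.1) < e.
Proof.
move=> acx e0; have [d d0 xd] := acx e e0.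
exists d => // s /andP[/allP s_ab /pairwiseP s_lt].
rewrite !(big_nth (0, 0)) !big_mkord => sd.
apply: (xd _ (fun i => (nth (0, 0) s i).1) (fun i => (nth (0, 0) s i).2)) => //.
- by move=> i; have /s_ab/and3P[] := mem_nth (0, 0) (ltn_ord i).
- pose I (p : R * R) := `]p.1, p.2[%classic : set R.
  have disj (i j : 'I_(size s)) z : (i < j)%N ->
      ~ (I (nth (0, 0) s i) z /\ I (nth (0, 0) s j) z).
    move=> ij []; rewrite /I /= !in_itv/= => /andP[iz _] /andP[_ zj].
    have := s_lt (0, 0) i j (ltn_ord i) (ltn_ord j) ij.
    by rewrite leNgt (lt_trans iz zj).
  move=> i j _ _ [z [zi zj]]; case: (ltngtP i j) => [ij|ji|/val_inj//].
    by case: (disj i j z ij); split; [exact: zi|exact: zj].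
  by case: (disj j i z ji); split; [exact: zj|exact: zi].
Qed.

(** Cut the interval at [t]: on each half the difference quotient based at [t] is at most [e], and
    the two increments add up. *)
Lemma derive_le0_straddle (phi : R -> R) (t e : R) :
  derivable phi t 1 -> 'D_1 phi t <= 0 -> 0 < e ->
  exists2 r, 0 < r & forall u v, t - r < u -> u <= t -> t <= v -> v < t + r ->
    phi v - phi u <= e * (v - u).
Proof.
move=> dphi phi_le0 e0.
have /cvgrPdist_le /(_ _ e0) [r /= r0 hr] := dphi.
exists r => // u v ru ut tv vr.
have slope s : s != t -> `|s - t| < r -> (phi s - phi t) / (s - t) <= e.
  move=> st str; have := hr (s - t); rewrite /ball_/= sub0r normrN subr_eq0.
  move=> /(_ str st); rewrite [X in phi (X + _)]mulr1 subrK [_ *: _]mulrC.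
  rewrite ler_norml => /andP[+ _]; move: phi_le0; rewrite /derive.
  set D := lim _; set q := _ / _ => D0 Dq.
  rewrite -/q in Dq *; lra.
have phiv : phi v - phi t <= e * (v - t).
  have [->|vt] := eqVneq v t; first by rewrite !subrr mulr0.
  have vt0 : 0 < v - t by rewrite subr_gt0 lt_neqAle eq_sym vt.
  by rewrite -ler_pdivrMr// slope// gtr0_norm//; lra.
have phiu : phi t - phi u <= e * (t - u).
  have [->|ut'] := eqVneq u t; first by rewrite !subrr mulr0.
  have ut0 : 0 < t - u by rewrite subr_gt0 lt_neqAle ut'.
  rewrite -ler_pdivrMr// -(opprB u t) invrN mulrN -mulNr opprB slope//.
  by rewrite distrC gtr0_norm//; lra.
by lra.
Qed.

(** Because the local step goes from some [u] before [t] to any [v] after it, it jumps over the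
    supremum of the points where [S] holds without knowing [S] there. *)
Lemma real_induction (a b : R) (S : R -> Prop) : a <= b -> S a ->
  (forall t, a <= t <= b -> exists2 r, 0 < r & forall u v,
     a <= u -> t - r < u -> u <= t -> t <= v -> v < t + r -> v <= b ->
     S u -> S v) ->
  S b.
Proof.
move=> ab Sa Sloc.
pose A := [set t | [/\ a <= t, t <= b & S t]].
have Aa : A a by [].
have supA : has_sup A by split; [exists a|exists b => t []].
have ac : a <= sup A by apply: ub_le_sup => //; exact: supA.2.
have cb : sup A <= b by apply: ge_sup => [|t []//]; exists a.
have [|r r0 hr] := Sloc (sup A); first by rewrite ac.
have [u [au ub Su] cu] := sup_adherent r0 supA.
have uc : u <= sup A by apply: ub_le_sup => //; exact: supA.2.
pose v := Num.min (sup A + r / 2) b.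
have cv : sup A <= v by rewrite le_min cb andbT lerDl divr_ge0// ltW.
have vr : v < sup A + r by rewrite gt_min ltrD2l gtr_pMr// invf_lt1// ltr1n.
have vb : v <= b by rewrite ge_min lexx orbT.
have Sv : S v by apply: (hr u v).
have vc : v <= sup A.
  by apply: ub_le_sup; [exact: supA.2|split=> //; exact: le_trans cv].
suff <- : v = b by [].
have r2 : 0 < r / 2 by rewrite divr_gt0.
move: vc; rewrite /v ge_min => /orP[|bc]; first by lra.
by apply/min_idPr; rewrite (le_trans bc)// lerDl divr_ge0// ltW.
Qed.

(* The exceptional null set is covered by an open set U of small measure; real
   induction on t bounds the increment of phi over [a, t] by e * (t - a) plus
   its variation over a chain s of intervals inside U. *)
Lemma ae_derive_le0_le (phi : R -> R) (a b : R) : a <= b ->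
  (forall e, 0 < e -> exists2 d, 0 < d & forall s, chain a b s ->
    \sum_(p <- s) (p.2 - p.1) < d -> \sum_(p <- s) `|phi p.2 - phi p.1| < e) ->
  {ae mu, forall t, a < t < b -> derivable phi t 1 /\ 'D_1 phi t <= 0} ->
  phi b <= phi a.
Proof.
move=> ab ac_phi ae_phi; rewrite -subr_le0; apply/ler_addgt0Pr => e0 e0_gt0; rewrite add0r.
(* Half of the budget is spent on the slope and half on the chain: [e0 = e * (b - a) + e]. *)
pose e := e0 / (b - a + 1).
have ba1 : 0 < b - a + 1 by lra.
have e_gt0 : 0 < e by rewrite divr_gt0.
have -> : e0 = e * (b - a) + e by rewrite /e; field; rewrite gt_eqF.
have [d d0 hd] := ac_phi e e_gt0.
have [N [mN muN0 subN]] : mu.-negligible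
    ([set t | ~ (a < t < b -> derivable phi t 1 /\ 'D_1 phi t <= 0)]
     `|` ([set a] `|` [set b])).
  apply: negligibleU => //; apply: negligibleU;
  by apply/negligibleP; [exact: measurable_set1|exact: lebesgue_measure_set1].
have [U [oU NU muUN]] : exists U : set R,
    [/\ open U, N `<=` U & (mu (U `\` N) < d%:E)%E].
  by apply: lebesgue_regularity_outer => //; rewrite [X in (X < _)%E]muN0.
have mU : measurable U by exact: measurable_realfun.open_measurable.
have muU : (mu U < d%:E)%E.
  apply: le_lt_trans muUN; rewrite -[leRHS]add0e -[X in (_ <= X + _)%E]muN0.
  have mUN : measurable (U `\` N) by exact: measurableD.
  by rewrite -measureU ?setDIK// setDUK.
pose S t := exists s, [/\ chain a t s,
  ((\sum_(p <- s) (p.2 - p.1))%:E <= mu (U `&` `[a, t]))%E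
  & phi t - phi a <= e * (t - a) + \sum_(p <- s) `|phi p.2 - phi p.1|].
have mUI (i : interval R) : measurable (U `&` [set` i] : set R).
  by apply: measurableI => //; exact: (measurable_itv i).
have mu_le (A B : set R) :
    measurable A -> measurable B -> A `<=` B -> (mu A <= mu B)%E.
  by move=> mA mB AB; apply: le_measure => //; rewrite inE.
have chainW t v s : t <= v -> chain a t s -> chain a v s.
  move=> tv /andP[/allP hs hp]; apply/andP; split=> //; apply/allP => p /hs.
  by move=> /and3P[-> -> /le_trans]; apply.
have [s [s_chain s_mu s_phi]] : S b.
  apply: (real_induction ab).
    by exists [::]; rewrite !big_nil !subrr mulr0 addr0; split.
  move=> t /andP[at_ tb].
  (* Inside [U] the new interval joins the chain, its length being paid by the measure of [U];
     outside [U] the derivative exists and the increment is paid by the slope [e]. *)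
  have [Ut|nUt] := pselect (U t).
    have /nbhs_ballP[r /= r0 rU] := open_nbhs_nbhs (conj oU Ut).
    exists r => // u v au tru ut tv vtr vb [s [s_chain s_mu s_phi]].
    have uv := le_trans ut tv.
    exists ((u, v) :: s); rewrite !big_cons /=; split.
    - have /andP[/allP hs hp] := s_chain; apply/andP; split => /=.
        rewrite au uv lexx/=; apply/allP => p /hs /and3P[-> ->] /le_trans; exact.
      by rewrite hp andbT; apply/allP => p /hs /and3P[].
    - have -> : U `&` `[a, v] = (U `&` `[a, u]) `|` `]u, v]%classic.
        apply/seteqP; split=> z /=; rewrite !in_itv/=.
          by move=> [Uz /andP[az zv]]; case: (leP z u) => zu; [left|right]; rewrite ?az ?zu.
        move=> [[Uz /andP[az zu]]|/andP[uz zv]].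
          by rewrite az (le_trans zu uv).
        split; last by rewrite zv (le_trans au (ltW uz)).
        by apply: rU; rewrite /ball/= ltr_norml; lra.
      have disj : (U `&` `[a, u]) `&` `]u, v]%classic = set0.
        apply/seteqP; split => // z /= [[_]]; rewrite !in_itv/=.
        by move=> /andP[_ zu] /andP[uz _]; move: uz; rewrite ltNge zu.
      have -> : mu ((U `&` `[a, u]) `|` `]u, v]%classic) =
          (mu (U `&` `[a, u]) + mu `]u, v]%classic)%E.
        by apply: measureU; [exact: mUI|exact: (measurable_itv `]u, v])|].
      rewrite EFinD addeC leeD// lebesgue_measure_itv/= lte_fin.
      case: ltP => // vu; rewrite lee_fin subr_le0//.
    - have := ler_norm (phi v - phi u).
      have : 0 <= e * (v - u) by rewrite mulr_ge0 ?subr_ge0// ltW.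
      by lra.
  have [/andP[ta tb'] dphi] : a < t < b /\
      (derivable phi t 1 /\ 'D_1 phi t <= 0).
    have nNt : ~ N t by move/NU.
    have tab : a < t < b.
      rewrite !lt_neqAle at_ tb !andbT; apply/andP; split; apply/eqP => tE.
        by apply: nNt; apply: subN; right; left.
      by apply: nNt; apply: subN; right; right.
    split=> //; apply: contrapT => h; apply: nNt; apply: subN; left => /=.
    by move=> /(_ tab).
  have [r r0 hr] := derive_le0_straddle dphi.1 dphi.2 e_gt0.
  exists r => // u v au tru ut tv vtr vb [s [s_chain s_mu s_phi]].
  have uv := le_trans ut tv.
  exists s; split; first exact: chainW s_chain.
    apply: (le_trans s_mu); apply: mu_le; [exact: mUI|exact: mUI|].
    move=> z /= [Uz]; rewrite !in_itv/= => /andP[-> zu].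
    by rewrite (le_trans zu).
  by have := hr u v tru ut tv vtr; lra.
apply: (le_trans s_phi); rewrite lerD2l ltW// hd//.
rewrite -lte_fin (le_lt_trans s_mu)// (le_lt_trans _ muU)//.
by apply: mu_le => //; exact: subIsetl.
Qed.

End absolutely_continuous.

(** * Almost everywhere differentiability of Lipschitz functions *)

Section lipschitz_derivable.
Context {R : realType}.
Notation mu := (@lebesgue_measure R).

Lemma lipschitz_continuous (V : normedModType R) (g : R -> V) (L : R) :
  (forall s t, `|g s - g t| <= L * `|s - t|) -> continuous g.
Proof.
move=> gL t; apply/cvgrPdist_le => e e0; near=> s.
have K0 : 0 < `|L| + 1 by rewrite ltr_wpDl.
apply: (le_trans (gL _ _)); apply: (@le_trans _ _ ((`|L| + 1) * `|t - s|)).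
  by rewrite ler_wpM2r// (le_trans (ler_norm L))// lerDl.
rewrite mulrC -ler_pdivlMr//; near: s.
by apply: (@cvgr_dist_le _ _ _ _ _ id t); [exact: cvg_id|exact: divr_gt0].
Unshelve. all: by end_near. Qed.

Lemma lebesgue_stieltjes_ocitv (H : cumulative R R) (a b : R) : a <= b ->
  lebesgue_stieltjes_measure H `]a, b]%classic = (H b - H a)%:E.
Proof.
move=> ab; rewrite /lebesgue_stieltjes_measure /measure_extension/=.
by rewrite measurable_mu_extE/= ?wlength_itv_bnd//; exact: is_ocitv.
Qed.

(** Both sides are infima over countable covers by half-open intervals, and the two lengths compare
    interval by interval. *)
Lemma lebesgue_stieltjes_le (H : cumulative R R) (K : R) (A : set R) : 0 < K ->
  (forall s t, s <= t -> H t - H s <= K * (t - s)) ->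
  (lebesgue_stieltjes_measure H A <= K%:E * mu A)%E.
Proof.
move=> K0 HK.
rewrite muleC -lee_pdivrMr//.
apply: le_ereal_inf_tmp => _ [F [mF AF] <-].
rewrite lee_pdivrMr// muleC -nneseriesZl//.
apply: (@le_trans _ _ (\sum_(0 <= k <oo) wlength H (F k))%E).
  by apply: ereal_inf_lbound; exists F.
apply: lee_nneseries => [*|k _]; first exact: wlength_ge0.
have [[a b] _ /= <-] := mF k.
have [ab|ba] := leP a b.
  by rewrite !wlength_itv_bnd//= -EFinM lee_fin HK.
by rewrite set_itv_ge ?wlength0 ?mule0//= bnd_simp -leNgt ltW.
Qed.

(** Adding [L * t] makes [g] nondecreasing. The Stieltjes measure of the sum is absolutely
    continuous, so by Radon-Nikodym the sum is an indefinite integral up to a constant, which [FTC1]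
    differentiates almost everywhere. *)
Lemma lipschitz_ae_derivable (g : R -> R) (L : R) :
  (forall s t, `|g s - g t| <= L * `|s - t|) ->
  {ae mu, forall t, derivable g t 1}.
Proof.
move=> gL.
have L0 : 0 <= L by have := gL 1 0; rewrite subr0 normr1 mulr1; exact: le_trans.
pose H t := g t + L * t.
have H_nd : {homo H : s t / s <= t}.
  move=> s t st; rewrite /H; have := gL s t.
  by rewrite ler_norml (distrC s) ger0_norm ?subr_ge0//; lra.
have H_lip s t : s <= t -> H t - H s <= (L + L + 1) * (t - s).
  move=> st; have := gL t s.
  by rewrite ler_norml (ger0_norm (x := t - s)) ?subr_ge0// /H; lra.
have H_rc : right_continuous H.
  apply: right_continuousW => t; apply: cvgD; first exact: (lipschitz_continuous gL).
  by apply: cvgM; [exact: cvg_cst|exact: cvg_id].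
pose Hc : cumulative R R := HB.pack H (isCumulative.Build R _ R H H_nd H_rc).
(* Restricting to bounded intervals makes the Stieltjes measure finite and its density integrable;
   countably many of them cover the line. *)
suff ae_k (k : nat) : {ae mu, forall t, `|t| < k%:R -> derivable g t 1}.
  apply: (negligibleS _ (negligible_bigcup ae_k)) => t /= dt.
  exists (Num.bound `|t|) => //= h; apply: dt; apply: h.
  exact: Num.Theory.archi_boundP.
pose D := `]- k%:R, k%:R]%classic : set (measurableTypeR R).
have mD : measurable D by exact: measurable_itv.
have LS_D : (lebesgue_stieltjes_measure Hc D < +oo)%E.
  by rewrite lebesgue_stieltjes_ocitv ?ltry// ge0_cp.
pose nu : {finite_measure set (measurableTypeR R) -> \bar R} := mfrestr mD LS_D.
have nu_mu : nu `<< mu.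
  apply/null_content_dominatesP => A mA muA0.
  rewrite /nu/= /mfrestr /mrestr/=.
  apply/eqP; rewrite -measure_le0.
  apply: (@le_trans _ _ (lebesgue_stieltjes_measure Hc A)).
    by apply: le_mu_ext => //; exact: subIsetl.
  rewrite (le_trans (lebesgue_stieltjes_le (H := Hc) A _ H_lip)) ?ltr_wpDl ?addr_ge0//.
  by rewrite [X in (_ * X)%E]muA0 mule0.
have [h [h0 hfin hint hE]] := radon_nikodym_sigma_finite nu_mu.
have EFinh : EFin \o (fine \o h) = h by apply/funext => t /=; rewrite fineK.
have int_h A : measurable A -> mu.-integrable A (EFin \o (fine \o h)).
  by move=> mA; rewrite EFinh; apply: integrableS hint.
have := @FTC1 R (fine \o h) (BRight (- k%:R)) (fun y => int_h _ (measurable_itv _))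
  (open_integrable_locally openT (int_h _ measurableT)).
apply: filterS; first exact: (ae_filter_ringOfSetsType mu).
move=> t /= dF tk.
move: (tk); rewrite ltr_norml => /andP[kt tk'].
have [dFt _] := dF kt.
have : derivable H t 1.
  pose F y := \int[mu]_(t in `]- k%:R, y]) (fine \o h) t.
  have FE y : - k%:R <= y <= k%:R -> F y = H y - H (- k%:R).
    move=> /andP[ky yk]; rewrite /F /Rintegral.
    have -> : (\int[mu]_(x in `](- k%:R)%R, y]) ((fine \o h) x)%:E
        = \int[mu]_(x in `](- k%:R)%R, y]) h x)%E.
      by apply: eq_integral => x _ /=; rewrite fineK.
    rewrite -hE; last exact: (measurable_itv `](- k%:R), y]).
    rewrite /nu/= /mfrestr /mrestr setIidl.
      by rewrite lebesgue_stieltjes_ocitv.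
    move=> z; rewrite /D /= !in_itv/= => /andP[-> zy] /=; exact: le_trans yk.
  apply: (@near_eq_derivable _ _ _ (F \+ cst (H (- k%:R)))); last first.
    by apply: derivableD => //; exact: derivable_cst.
  near=> y; rewrite /= FE ?subrK//.
  apply/andP; split; apply/ltW; near: y; [exact: lt_nbhsr|exact: lt_nbhsl].
move=> dH; have -> : g = H \- ( *%R L) by apply/funext => s; rewrite /H /=; lra.
by apply: derivableB => //; exact: derivableM.
Unshelve. all: by end_near. Qed.

End lipschitz_derivable.

Lemma lipschitz_abs_continuous (R : realType) (n : nat) (x : R -> 'rV[R]_n)
    (V a b : R) :
  0 <= V -> (forall s t, enorm (x s - x t) <= V * `|s - t|) ->
  abs_continuous a b x.
Proof.
move=> V0 xV e e0; have V1 : 0 < V + 1 by rewrite ltr_wpDl.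
exists (e / (V + 1)); first exact: divr_gt0.
move=> m u v uv _ uvd.
have uvs : 0 <= \sum_(i < m) (v i - u i).
  by apply: sumr_ge0 => i _; have := uv i; lra.
apply: (@le_lt_trans _ _ (V * \sum_(i < m) (v i - u i))).
  rewrite mulr_sumr; apply: ler_sum => i _; apply: (le_trans (xV _ _)).
  by rewrite ger0_norm//; have := uv i; lra.
move: uvd; rewrite ltr_pdivlMr//; lra.
Qed.

Lemma lipschitz_ae_derivable_rV (R : realType) (n : nat) (x : R -> 'rV[R]_n)
    (V : R) : (forall s t, enorm (x s - x t) <= V * `|s - t|) ->
  {ae (@lebesgue_measure R), forall t, derivable x t 1}.
Proof.
move=> xV.
have xi (i : 'I_n) :
    {ae (@lebesgue_measure R), forall t, derivable (fun s => x s ord0 i) t 1}.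
  apply: (@lipschitz_ae_derivable _ _ V) => s t; apply: le_trans (xV s t).
  by have := coord_le_enorm (x s - x t) i; rewrite !mxE.
have aeF := ae_filter_ringOfSetsType (@lebesgue_measure R).
apply: (@filterS _ _ aeF _ _ _ (filter_forall aeF xi)) => t /= xt.
by apply/derivable_mxP => i j; rewrite (ord1 i).
Qed.


(** * Prox-regular sets *)

Section geometry.
Context {R : realType} {n : nat}.
Implicit Types (C : set 'rV[R]_n) (x y c v w : 'rV[R]_n).

Lemma continuous_enormB y : continuous (fun z : 'rV[R]_n => enorm (y - z)).
Proof.
move=> z; have yz : (fun u => y - u) @ nbhs z --> y - z.
  by apply: cvgB; [exact: cvg_cst|exact: cvg_id].
exact: (cvg_enorm yz).
Qed.

Lemma closed_enorm_ball y r : closed [set z : 'rV[R]_n | enorm (y - z) <= r].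
Proof.
apply: (@closed_comp _ _ _ [set s | s <= r]) => [z _|]; last exact: closed_le.
exact: continuous_enormB.
Qed.

Lemma compact_enorm_ball y r : compact [set z : 'rV[R]_n | enorm (y - z) <= r].
Proof.
apply: bounded_closed_compact; last exact: closed_enorm_ball.
exists (`|y| + r); split; first exact: num_real.
move=> M hM z /= yz; rewrite (le_trans _ (ltW hM))//.
rewrite -[z](subKr y) (le_trans (ler_normB _ _))// lerD2l.
exact: le_trans (norm_le_enorm _) yz.
Qed.

(** Minimize over the compact part of [C] at distance at most [enorm (y - c0)]; the other points are
    farther than [c0]. *)
Lemma proj_exists C y : closed C -> C !=set0 -> exists x, Defs.proj y C x.
Proof.
move=> Ccl [c0 Cc0].
pose A := C `&` [set z | enorm (y - z) <= enorm (y - c0)].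
have Acpt : compact A.
  apply: subclosed_compact (@compact_enorm_ball y (enorm (y - c0))) _ => [|z []//].
  by apply: closedI => //; exact: closed_enorm_ball.
have [||x /[1!inE] -[Cx xc0] xmin] := @EVT_min_rV R n (fun z => enorm (y - z)) A _ Acpt.
- by exists c0; split => //=.
- exact: (continuous_subspaceT (@continuous_enormB y)).
exists x; split => // c Cc.
have [cc0|/ltW cc0] := leP (enorm (y - c)) (enorm (y - c0)).
  by apply: xmin; rewrite inE.
exact: le_trans xc0 cc0.
Qed.

(** The distance to a closed set is attained at a projection, so the bound [r] holds without
    slack. *)
Lemma hausdorff_dist_close C1 C2 r x : closed C2 -> C2 !=set0 ->
  (hausdorff_dist C1 C2 <= r%:E)%E -> C1 x ->
  exists2 c, C2 c & enorm (x - c) <= r.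
Proof.
move=> C2cl C20; rewrite /hausdorff_dist ge_max => /andP[_ dr] C1x.
have [p [C2p pmin]] := proj_exists x C2cl C20.
exists p => //; rewrite -lee_fin; apply: le_trans dr.
apply: (@le_trans _ _ (set_dist x C2)); last by apply: ereal_sup_ubound; exists x.
by apply: le_ereal_inf_tmp => _ [c C2c <-]; rewrite lee_fin pmin.
Qed.

(** From an interior point, a small move along [v] would stay in [C] and come strictly closer to
    [x + a *: v]. This gives access to [prox_regular], which speaks of frontier points. *)
Lemma normal_cone_frontier C x v : C x -> normal_cone C x v -> v != 0 ->
  frontier C x.
Proof.
move=> Cx [a a0 [_ xmin]] v0; split; first exact: subset_closure.
move=> Cxi.
have cont : (fun s : R => x + s *: v) @ (0 : R) --> x.
  rewrite -[X in _ --> X]addr0; apply: cvgD; first exact: cvg_cst.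
  rewrite -[X in _ --> X](scale0r v); apply: cvgZl; exact: cvg_id.
have /cont /nbhs_ballP[r /= r0 rC] := Cxi.
pose s := Num.min (r / 2) (a / 2).
have s0 : 0 < s by rewrite lt_min !divr_gt0.
have Cs : C (x + s *: v).
  apply: rC; rewrite /ball/= sub0r normrN gtr0_norm// gt_min.
  by rewrite ltr_pdivrMr// ltr_pMr// ltr1n.
have sa : s < a by rewrite gt_min [a / 2 < a]ltr_pdivrMr// ltr_pMr// ltr1n orbT.
have := xmin _ Cs.
rewrite (addrC x (a *: v)) addrK (addrC x) opprD addrACA subrr addr0 -scalerBl.
rewrite !enormZ ler_pM2r ?enorm_gt0// gtr0_norm// gtr0_norm ?subr_gt0//.
by lra.
Qed.

(** As [c] avoids the tangent ball, its distance to the center is at least [eta]; expanding the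
    square gives the inequality after scaling by [enorm w / (2 * eta)]. *)
Lemma prox_regular_normal eta C x c w : 0 < eta -> prox_regular eta C ->
  C x -> normal_cone C x w -> C c ->
  dotr w (c - x) <= enorm w / (2 * eta) * enorm (c - x) ^+ 2.
Proof.
move=> eta0 Cprox Cx Nw Cc; have [->|w0] := eqVneq w 0.
  by rewrite dot0r enorm0 !mul0r.
have nw0 : 0 < enorm w by rewrite enorm_gt0.
have noball := Cprox x w (normal_cone_frontier Cx Nw w0) Nw w0.
have : eta <= enorm (c - x - (eta / enorm w) *: w).
  rewrite leNgt -addrA -opprD; apply/negP => cb.
  by have : set0 c by rewrite -noball.
rewrite -ler_sqr ?nnegrE ?enorm_ge0 ?(ltW eta0)// (enorm_sqrB (c - x)) enormZ dotrZr.
rewrite (dotrC _ w) gtr0_norm ?divr_gt0// divfK ?gt_eqF//.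
move=> h; have {h} : 2 * (eta / enorm w * dotr w (c - x)) <= enorm (c - x) ^+ 2.
  by lra.
have k0 : 0 < enorm w / (2 * eta) by rewrite divr_gt0// mulr_gt0.
rewrite -(ler_pM2l k0); congr (_ <= _).
by field; rewrite !gt_eqF.
Qed.

Lemma normal_coneI K C x w : C x ->
  (forall c, C c -> dotr w (c - x) <= K * enorm (c - x) ^+ 2) ->
  normal_cone C x w.
Proof.
move=> Cx wK; pose a := (2 * (`|K| + 1))^-1.
have K1 : 0 < `|K| + 1 by rewrite ltr_wpDl.
have a0 : 0 < a by rewrite invr_gt0 mulr_gt0.
exists a => //; split => // c Cc.
rewrite addrAC subrr add0r -ler_sqr ?nnegrE ?enorm_ge0//.
have -> : x + a *: w - c = a *: w - (c - x) by rewrite opprB addrAC addrC.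
rewrite enorm_sqrB dotrZl -addrA lerDl.
have := wK c Cc; rewrite -(ler_pM2l a0) => h.
have : a * K * enorm (c - x) ^+ 2 <= 2^-1 * enorm (c - x) ^+ 2.
  rewrite ler_wpM2r ?sqr_ge0// /a invfM -mulrA ger_pMr ?invr_gt0//.
  by rewrite mulrC ler_pdivrMr// mul1r (le_trans (ler_norm K))// lerDl.
by lra.
Qed.

Lemma is_derive_dotr (p q : R -> 'rV[R]_n) t :
  derivable p t 1 -> derivable q t 1 ->
  is_derive t 1 (fun s => dotr (p s) (q s))
    (dotr ('D_1 p t) (q t) + dotr (p t) ('D_1 q t)).
Proof.
move=> dp dq; rewrite (derive_mx dp) (derive_mx dq).
have /derivable_mxP dpi := dp; have /derivable_mxP dqi := dq.
rewrite /dotr -big_split/=.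
have -> : (fun s => \sum_(i < n) p s ord0 i * q s ord0 i) =
    \sum_(i < n) ((fun s => p s ord0 i) * (fun s => q s ord0 i)).
  by apply/funext => s; rewrite fct_sumE.
apply: is_derive_sum => i; rewrite !mxE.
have hp := DeriveDef (dpi ord0 i) erefl; have hq := DeriveDef (dqi ord0 i) erefl.
apply: is_derive_eq; rewrite /GRing.scale/=; ring.
Qed.

End geometry.

(** * The sweeping process *)

(** Compactness gives a cluster point, and an ultrafilter converges to its cluster points since it
    contains each neighbourhood or its complement. *)
Lemma ultra_cvg_compact (T : topologicalType) (I : Type) (U : set_system I)
    (UU : UltraFilter U) (p : I -> T) (A : set T) :
  compact A -> (forall i, A (p i)) -> exists l : T, p @ U --> l.
Proof.
move=> Acpt pA; have [|l [_ lcl]] := Acpt (p @ U) (fmap_proper_filter p _).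
  by apply: (@filterS _ U _ setT) => [i _|]; [exact: pA|exact: filterT].
exists l => V Vl; have [//|UV] := in_ultra_setVsetC (p @^-1` V) UU.
by have [y [/= nVy Vy]] := lcl (~` V) V UV Vl.
Qed.


Section sweeping.
Context {R : realType} {n : nat} {eta : R} (eta_gt0 : 0 < eta)
  {C : R -> set 'rV[R]_n} (C_nonempty : forall t, C t !=set0)
  (C_closed : forall t, closed (C t))
  (C_prox : forall t, prox_regular eta (C t))
  {LC : R} (LC_ge0 : 0 <= LC)
  (C_lip : forall t1 t2 : R,
     (hausdorff_dist (C t1) (C t2) <= (LC * `|t1 - t2|)%:E)%E)
  {f : R -> 'rV[R]_n -> 'rV[R]_n}
  {Lf : R} (Lf_gt0 : 0 < Lf)
  (f_lip : forall (t1 t2 : R) (x1 x2 : 'rV[R]_n),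
     enorm (f t1 x1 - f t2 x2) <= Lf * `|t1 - t2| + Lf * enorm (x1 - x2))
  {Mf : R} (Mf_ge0 : 0 <= Mf)
  (f_bound : forall (t : R) (x : 'rV[R]_n),
     (\bigcup_(s in setT) C s) x -> enorm (f t x) <= Mf)
  {alpha : R} (alpha_gt0 : 0 < alpha)
  (f_mono : forall (t : R) (x1 x2 : 'rV[R]_n),
     alpha * enorm (x1 - x2) ^+ 2 <= dotr (f t x1 - f t x2) (x1 - x2))
  (alpha_big : (LC + Mf) / eta < alpha).
Notation mu := (@lebesgue_measure R).

(** * Bounds on the moving sets and on the normal part of the velocity *)

Lemma C_close t s x : C t x -> exists2 c, C s c & enorm (x - c) <= LC * `|t - s|.
Proof. exact: hausdorff_dist_close. Qed.

Lemma f_le t s x : C s x -> enorm (f t x) <= Mf.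
Proof. by move=> Cx; apply: f_bound; exists s. Qed.

Lemma C_diam s t x y : C s x -> C t y -> enorm (x - y) <= 2 * Mf / alpha.
Proof.
move=> Cx Cy; rewrite ler_pdivlMr// mulrC.
have [->|xy] := eqVneq (enorm (x - y)) 0; first by rewrite mulr0 mulr_ge0.
have xy0 : 0 < enorm (x - y) by rewrite lt_neqAle eq_sym xy enorm_ge0.
(* Both points may be tested with [f] at the common time 0, since [Mf] bounds [f] at every time on
   the union of all the sets. *)
rewrite -(ler_pM2r xy0) -mulrA -expr2 (le_trans (f_mono 0 x y))//.
rewrite (le_trans (dotr_le _ _))// ler_pM2r// (le_trans (ler_enormB _ _))//.
by rewrite mulr_natl mulr2n lerD// (f_le _ Cx, f_le _ Cy).
Qed.

(* x (t - h) lies within LC * h of C t, so the inequality of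
   [prox_regular_normal] applies to it up to an error of order h ^ 2. *)
Lemma velocity_normal_ge x t r w : 0 < r ->
  (forall s, t - r < s <= t -> C s (x s)) -> derivable x t 1 ->
  normal_cone (C t) (x t) w -> - (LC * enorm w) <= dotr w ('D_1 x t).
Proof.
move=> r0 Cx dx Nw.
have Cxt : C t (x t) by apply: Cx; rewrite lexx andbT; lra.
pose q (h : R) := h^-1 *: (x (h + t) - x t).
have qE : q = fun h => h^-1 *: (x (h *: 1 + t) - x t).
  by apply/funext => h; rewrite /q [_ *: 1]mulr1.
(* The quotient looks backward: dividing the normal inequality by a negative [h] turns it into a
   lower bound. *)
have qD : q @ 0^'- --> 'D_1 x t.
  by rewrite qE; exact: (cvg_dnbhs_at_left dx).
pose k := enorm w / (2 * eta).
have k0 : 0 <= k by rewrite divr_ge0 ?enorm_ge0// mulr_ge0// ltW.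
have wq : (fun h => dotr w (q h)) @ 0^'- --> dotr w ('D_1 x t).
  by apply: cvg_dotr qD; exact: cvg_cst.
have rhs : (fun h : R => k * (enorm (q h) + LC) ^+ 2 * h - LC * enorm w) @ 0^'-
    --> - (LC * enorm w).
  rewrite -[X in _ --> X]add0r; apply: cvgB; last exact: cvg_cst.
  rewrite -[X in _ --> X](mulr0 (k * (enorm ('D_1 x t) + LC) ^+ 2)).
  apply: cvgM; last by apply: cvg_at_left_filter; exact: cvg_id.
  apply: cvgM; first exact: cvg_cst.
  rewrite expr2; under eq_fun do rewrite expr2.
  by apply: cvgM; (apply: cvgD; [exact: cvg_enorm|exact: cvg_cst]).
apply: ler_cvg_to rhs wq _.
near=> h.
have h0 : h < 0 by near: h; exact: nbhs_left_lt.
have hr : - r < h by near: h; apply: nbhs_left_gt; lra.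
have [c Ctc xc] : exists2 c, C t c & enorm (x (h + t) - c) <= LC * - h.
  have -> : - h = `|h + t - t| by rewrite addrK ltr0_norm.
  by apply: C_close; apply: Cx; lra.
have h1 := prox_regular_normal eta_gt0 (@C_prox t) Cxt Nw Ctc.
have xq : x (h + t) - x t = h *: q h.
  by rewrite /q scalerA divff ?scale1r// lt_eqF.
have ce : c - x t = h *: q h - (x (h + t) - c) by rewrite -xq opprB [RHS]addrC subrKA.
have nc : enorm (c - x t) <= - h * (enorm (q h) + LC).
  by rewrite ce (le_trans (ler_enormB _ _))// enormZ ltr0_norm//; lra.
have nc2 : enorm (c - x t) ^+ 2 <= (- h * (enorm (q h) + LC)) ^+ 2.
  by rewrite ler_sqr ?nnegrE ?enorm_ge0// mulr_ge0 ?addr_ge0 ?enorm_ge0//; lra.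
have we := dotr_le w (x (h + t) - c).
have we2 : enorm w * enorm (x (h + t) - c) <= enorm w * (LC * - h).
  by rewrite ler_wpM2l ?enorm_ge0.
move: h1; rewrite ce dotrBr dotrZr -ce -/k => h1.
have h2 : k * enorm (c - x t) ^+ 2 <= k * (- h * (enorm (q h) + LC)) ^+ 2.
  by rewrite ler_wpM2l.
have nh0 : 0 < - h by lra.
rewrite -(ler_pM2l nh0).
lra.
Unshelve. all: by end_near. Qed.

(** Pairing the velocity equation with [w] and using [velocity_normal_ge] gives [enorm w ^+ 2 + dotr
    w (f t (x t)) <= LC * enorm w]; bound [f] by [Mf] and cancel [enorm w]. *)
Lemma normal_part_bound x t r w : 0 < r ->
  (forall s, t - r < s <= t -> C s (x s)) -> derivable x t 1 ->
  normal_cone (C t) (x t) w -> - 'D_1 x t = w + f t (x t) ->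
  enorm w <= LC + Mf.
Proof.
move=> r0 Cx dx Nw xE.
have Cxt : C t (x t) by apply: Cx; rewrite lexx andbT; lra.
have [->|w0] := eqVneq w 0; first by rewrite enorm0 addr_ge0.
have nw0 : 0 < enorm w by rewrite enorm_gt0.
have := velocity_normal_ge r0 Cx dx Nw.
rewrite -(opprK ('D_1 x t)) xE dotrNr dotrDr -sqr_enorm lerN2 => h.
have h1 := le_trans (ler_norm _) (ler_norm_dotr (- w) (f t (x t))).
rewrite dotrNl enormN in h1.
have h2 : enorm w * enorm (f t (x t)) <= enorm w * Mf.
  by rewrite ler_pM2l// (f_le _ Cxt).
rewrite -(ler_pM2l nw0); rewrite expr2 in h; lra.
Qed.

(** * Contraction between two solutions, and uniqueness *)

Let rate := alpha - (LC + Mf) / eta.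

Lemma rate_gt0 : 0 < rate. Proof. by rewrite subr_gt0. Qed.

(** Each normal is tested at the other point and loses at most [(LC + Mf) / (2 * eta)] times the
    squared distance; the two losses are subtracted from the monotonicity constant [alpha]. *)
Lemma dissipation t x1 x2 w1 w2 : C t x1 -> C t x2 ->
  normal_cone (C t) x1 w1 -> normal_cone (C t) x2 w2 ->
  enorm w1 <= LC + Mf -> enorm w2 <= LC + Mf ->
  rate * enorm (x1 - x2) ^+ 2 <=
    dotr ((w1 + f t x1) - (w2 + f t x2)) (x1 - x2).
Proof.
move=> Cx1 Cx2 Nw1 Nw2 w1M w2M.
have h1 := prox_regular_normal eta_gt0 (@C_prox t) Cx1 Nw1 Cx2.
have h2 := prox_regular_normal eta_gt0 (@C_prox t) Cx2 Nw2 Cx1.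
have bound (w : 'rV[R]_n) : enorm w <= LC + Mf ->
    enorm w / (2 * eta) * enorm (x1 - x2) ^+ 2 <=
    (LC + Mf) / eta / 2 * enorm (x1 - x2) ^+ 2.
  move=> wM; rewrite ler_wpM2r ?sqr_ge0// -mulrA -invfM (mulrC eta).
  by rewrite ler_wpM2r// invr_ge0 mulr_ge0// ltW.
have b1 := bound _ w1M; have b2 := bound _ w2M.
have h3 := f_mono t x1 x2.
rewrite -(opprB x1 x2) dotrNr enormN in h1.
have -> : (w1 + f t x1) - (w2 + f t x2) = (w1 - w2) + (f t x1 - f t x2).
  by rewrite opprD addrACA.
rewrite dotrDl (dotrBl w1) /rate.
lra.
Qed.

Lemma ler_norm_dist_expR (k s t : R) : 0 <= k -> s <= t -> t <= 0 ->
  `|expR (k * t) - expR (k * s)| <= k * (t - s).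
Proof.
move=> k0 st t0; rewrite ger0_norm ?subr_ge0 ?ler_expR ?ler_wpM2l//.
have -> : k * s = k * t + - (k * (t - s)) by ring.
rewrite expRD -[X in X - _]mulr1 -mulrBr.
apply: (@le_trans _ _ (1 - expR (- (k * (t - s))))).
  rewrite ler_piMl// ?subr_ge0 -?expR0 ler_expR.
    by rewrite oppr_le0 mulr_ge0// subr_ge0.
  by rewrite mulr_ge0_le0.
by have := expR_ge1Dx (- (k * (t - s))); lra.
Qed.

Lemma sweeping_contraction (I : interval R) x1 x2 a b : a <= b ->
  `[a, b] `<=` [set` I] ->
  sweeping_solution C f I x1 -> sweeping_solution C f I x2 ->
  enorm (x1 b - x2 b) <= expR (- rate * (b - a)) * enorm (x1 a - x2 a).
Proof.
move=> ab abI [ac1 Cx1 ae1] [ac2 Cx2 ae2].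
have rate0 := rate_gt0.
have Iab t : a <= t <= b -> t \in I by move=> tab; apply: abI; rewrite /= in_itv.
pose z t := x1 t - x2 t.
(* The weight turns exponential decay into monotonicity of [phi], and is normalized to 1 at [b]. *)
pose phi t := expR ((2 * rate) * (t - b)) * dotr (z t) (z t).
have zB t : a <= t <= b -> enorm (z t) <= 2 * Mf / alpha.
  by move=> /Iab tI; apply: C_diam; [exact: Cx1|exact: Cx2].
set B := 2 * Mf / alpha in zB.
have B0 : 0 <= B by rewrite divr_ge0 ?mulr_ge0// ltW.
suff : phi b <= phi a.
  rewrite /phi subrr mulr0 expR0 mul1r -!sqr_enorm => h.
  rewrite -ler_sqr ?nnegrE ?mulr_ge0 ?expR_ge0 ?enorm_ge0// exprMn.
  rewrite -expRM_natl; move: h; congr (_ <= expR _ * _).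
  by ring.
apply: ae_derive_le0_le => //.
(* [phi] inherits absolute continuity: [2 * B] controls the increments of the squared distance,
   [2 * rate * B ^+ 2] those of the weight, and 1 keeps [K] positive. *)
- move=> e e0; pose K := 2 * B + 2 * rate * B ^+ 2 + 1.
  have K0 : 0 < K.
    by rewrite ltr_wpDl// addr_ge0// mulr_ge0 ?sqr_ge0// mulr_ge0// ltW.
  pose e3 := e / (3 * K); have e30 : 0 < e3 by rewrite divr_gt0// mulr_gt0.
  have [d1 d10 h1] := abs_continuous_chain (ac1 _ _ ab abI) e30.
  have [d2 d20 h2] := abs_continuous_chain (ac2 _ _ ab abI) e30.
  exists (Num.min e3 (Num.min d1 d2)); first by rewrite !lt_min e30 d10.
  move=> s s_ch; rewrite !lt_min => /and3P[se3 sd1 sd2].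
  have {h1} h1 := h1 s s_ch sd1; have {h2} h2 := h2 s s_ch sd2.
  have -> : e = K * (e3 + e3 + e3) by rewrite /e3; field; rewrite gt_eqF.
  apply: (@le_lt_trans _ _ (K * (\sum_(p <- s) enorm (x1 p.2 - x1 p.1) +
     \sum_(p <- s) enorm (x2 p.2 - x2 p.1) + \sum_(p <- s) (p.2 - p.1)))).
    rewrite -!big_split mulr_sumr !big_seq; apply: ler_sum => -[u v] /=.
    have /andP[/allP s_ab _] := s_ch => /s_ab /and3P[/= au uv vb].
    have zu := zB u (introT andP (conj au (le_trans uv vb))).
    have zv := zB v (introT andP (conj (le_trans au uv) vb)).
    have -> : phi v - phi u =
        expR (2 * rate * (v - b)) * (dotr (z v) (z v) - dotr (z u) (z u)) +
        (expR (2 * rate * (v - b)) - expR (2 * rate * (u - b))) * dotr (z u) (z u).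
      by rewrite /phi; ring.
    have E1 : expR (2 * rate * (v - b)) <= 1.
      by rewrite -expR0 ler_expR mulr_ge0_le0 ?subr_le0// mulr_ge0// ltW.
    have E2 : `|expR (2 * rate * (v - b)) - expR (2 * rate * (u - b))| <=
        2 * rate * (v - u).
      have -> : v - u = (v - b) - (u - b) by ring.
      by apply: ler_norm_dist_expR; rewrite ?lerB// ?subr_le0// mulr_ge0// ltW.
    have E3 : `|dotr (z v) (z v) - dotr (z u) (z u)| <=
        2 * B * (enorm (x1 v - x1 u) + enorm (x2 v - x2 u)).
      have -> : dotr (z v) (z v) - dotr (z u) (z u) = dotr (z v - z u) (z v + z u).
        by rewrite (dotrBl (z v)) !(dotrDr (z v) (z u)) (dotrC (z v) (z u)); ring.
      rewrite (le_trans (ler_norm_dotr _ _))// mulrC.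
      apply: ler_pM; rewrite ?enorm_ge0//.
        by rewrite (le_trans (ler_enormD _ _))//; lra.
      have -> : z v - z u = (x1 v - x1 u) - (x2 v - x2 u).
        by rewrite /z !opprB addrACA [RHS]addrACA; congr (_ + _); rewrite addrC.
      exact: ler_enormB.
    have E4 : dotr (z u) (z u) <= B ^+ 2.
      by rewrite -sqr_enorm ler_sqr ?nnegrE ?enorm_ge0.
    rewrite (le_trans (ler_normD _ _))// !normrM.
    rewrite (ger0_norm (expR_ge0 _)) (ger0_norm (dotrr_ge0 _)).
    have F1 : expR (2 * rate * (v - b)) * `|dotr (z v) (z v) - dotr (z u) (z u)|
        <= 2 * B * (enorm (x1 v - x1 u) + enorm (x2 v - x2 u)).
      by rewrite (le_trans _ E3)// ler_piMl.
    have F2 : `|expR (2 * rate * (v - b)) - expR (2 * rate * (u - b))| *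
        dotr (z u) (z u) <= 2 * rate * (v - u) * B ^+ 2.
      by apply: ler_pM; rewrite ?normr_ge0 ?dotrr_ge0.
    apply: (le_trans (lerD F1 F2)); rewrite /K.
    have n1 := enorm_ge0 (x1 v - x1 u); have n2 := enorm_ge0 (x2 v - x2 u).
    have uv0 : 0 <= v - u by lra.
    have BB : 0 <= 2 * rate * B ^+ 2 by rewrite mulr_ge0 ?sqr_ge0// mulr_ge0// ltW.
    have N0 : 0 <= enorm (x1 v - x1 u) + enorm (x2 v - x2 u) by rewrite addr_ge0.
    move: (enorm (x1 v - x1 u) + enorm (x2 v - x2 u)) N0 => N N0.
    have p1 := mulr_ge0 BB N0; have p2 := mulr_ge0 B0 uv0.
    lra.
  by rewrite ltr_pM2l// !ltrD.
- have aeF := ae_filter_ringOfSetsType mu.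
  apply: (@filterS2 _ _ aeF _ _ _ _ ae1 ae2) => t /= h1 h2 /andP[at_ tb].
  have tI : t \in I by apply: Iab; lra.
  have [d1 [w1 Nw1 /esym xE1]] := h1 tI; have [d2 [w2 Nw2 /esym xE2]] := h2 tI.
  have ta0 : 0 < t - a by lra.
  have loc x : (forall s, s \in I -> C s (x s)) ->
      forall s, t - (t - a) < s <= t -> C s (x s).
    by move=> Cx s st; apply: Cx; apply: Iab; lra.
  have w1M := normal_part_bound ta0 (loc _ Cx1) d1 Nw1 xE1.
  have w2M := normal_part_bound ta0 (loc _ Cx2) d2 Nw2 xE2.
  have dz : derivable z t 1 by exact: derivableB.
  have Dz : 'D_1 z t = - ((w1 + f t (x1 t)) - (w2 + f t (x2 t))).
    by rewrite /z deriveB// -xE1 -xE2 opprB opprK addrC.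
  have diss := dissipation (Cx1 t tI) (Cx2 t tI) Nw1 Nw2 w1M w2M.
  have dphi : is_derive t 1 phi (expR (2 * rate * (t - b)) *
     (2 * dotr ('D_1 z t) (z t) + 2 * rate * dotr (z t) (z t))).
    have dd := is_derive_dotr dz dz.
    have de : is_derive t 1 (fun t => expR (2 * rate * (t - b)))
        (expR (2 * rate * (t - b)) * (2 * rate)).
      apply: is_derive1_comp; apply: is_derive_eq.
      by rewrite /GRing.scale/=; ring.
    apply: is_derive_eq.
    by rewrite /GRing.scale/= (dotrC (z t) ('D_1 z t)); ring.
  split; first by have [] := dphi.
  rewrite derive_val mulr_ge0_le0 ?expR_ge0// Dz dotrNl -sqr_enorm.
  by move: diss; rewrite -/(z t); lra.
Qed.

Lemma sweeping_unique x1 x2 :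
  sweeping_solution C f `]-oo, +oo[ x1 -> sweeping_solution C f `]-oo, +oo[ x2 ->
  x1 = x2.
Proof.
move=> s1 s2; apply/funext => t; apply/eqP; rewrite -subr_eq0 -enorm_eq0.
apply: contraT => z0.
have {}z0 : 0 < enorm (x1 t - x2 t) by rewrite lt_neqAle eq_sym z0 enorm_ge0.
have rate0 := rate_gt0.
pose B := 2 * Mf / alpha.
have B0 : 0 <= B by rewrite divr_ge0 ?mulr_ge0// ltW.
(* Going back by this [s] makes [rate * s * enorm (x1 t - x2 t)] equal to [B]; with
   [1 + y <= expR y] the contraction then leaves no room for a positive distance at [t]. *)
pose s := B / (rate * enorm (x1 t - x2 t)).
have s0 : 0 <= s by rewrite divr_ge0// mulr_ge0 ?enorm_ge0// ltW.
have ts : t - s <= t by lra.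
have sub : `[t - s, t] `<=` [set` (`]-oo, +oo[ : interval R)] by [].
have := sweeping_contraction ts sub s1 s2.
have [_ C1 _] := s1; have [_ C2 _] := s2.
have := C_diam (C1 (t - s) isT) (C2 (t - s) isT); rewrite -/B.
have -> : - rate * (t - (t - s)) = - (rate * s) by ring.
rewrite expRN => zB h.
have e0 := expR_gt0 (rate * s).
have {}h : expR (rate * s) * enorm (x1 t - x2 t) <= B.
  by rewrite (le_trans _ zB)// mulrC -ler_pdivlMr// mulrC.
have : (1 + rate * s) * enorm (x1 t - x2 t) <= B.
  by rewrite (le_trans _ h)// ler_pM2r// expR_ge1Dx.
rewrite mulrDl mul1r.
have -> : rate * s * enorm (x1 t - x2 t) = B.
  by rewrite /s; field; rewrite !gt_eqF.
by lra.
Qed.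

(** * The catching-up scheme and its discrete estimates *)

Let M := LC + Mf.
Let B := 2 * Mf / alpha.

Lemma M_ge0 : 0 <= M. Proof. exact: addr_ge0. Qed.

Lemma diam_ge0 : 0 <= B. Proof. by rewrite divr_ge0 ?mulr_ge0// ltW. Qed.

Lemma catching_up (t0 h : R) : exists X : nat -> 'rV[R]_n, C t0 (X 0%N) /\
  forall k, Defs.proj (X k - h *: f (t0 + k%:R * h) (X k))
    (C (t0 + k.+1%:R * h)) (X k.+1).
Proof.
have /choice[g gP] : forall ty : R * 'rV[R]_n,
    exists x, Defs.proj ty.2 (C ty.1) x.
  by move=> ty; exact: proj_exists.
have [x0 Cx0] := C_nonempty t0.
pose X := fix X k := if k is k'.+1 then
  g (t0 + k'.+1%:R * h, X k' - h *: f (t0 + k'%:R * h) (X k')) else x0.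
by exists X; split=> // k; exact: (gP (_, _)).
Qed.

Section scheme.
Context {t0 h : R} (h_gt0 : 0 < h) {X : nat -> 'rV[R]_n} (X0 : C t0 (X 0%N))
  (XS : forall k, Defs.proj (X k - h *: f (t0 + k%:R * h) (X k))
    (C (t0 + k.+1%:R * h)) (X k.+1)).

Let T k := t0 + k%:R * h.
(** The displacement undone by the projection: a proximal normal at [X k.+1], playing the role of
    [h] times the normal part of the velocity. *)
Let w k := X k - h *: f (T k) (X k) - X k.+1.

Lemma scheme_mem k : C (T k) (X k).
Proof. by case: k => [|k]; [rewrite /T mul0r addr0|have [] := XS k]. Qed.

(** The projection is no farther than a point of the next set within [LC * h] of [X k], and the
    drift step adds at most [h * Mf]. *)
Lemma scheme_normal_le k : enorm (w k) <= h * M.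
Proof.
have [_ Xmin] := XS k; have [c Cc Xc] := C_close (T k.+1) (scheme_mem k).
apply: (le_trans (Xmin c Cc)).
rewrite addrAC (le_trans (ler_enormB _ _))// enormZ gtr0_norm// /M mulrDr.
rewrite lerD//; last by rewrite ler_pM2l// (f_le _ (scheme_mem k)).
apply: (le_trans Xc); rewrite mulrC ler_wpM2r//.
have -> : T k - T k.+1 = - h by rewrite /T -natr1; ring.
by rewrite normrN gtr0_norm.
Qed.

Lemma scheme_step_le k : enorm (X k.+1 - X k) <= h * (M + Mf).
Proof.
have -> : X k.+1 - X k = - (w k + h *: f (T k) (X k)).
  by rewrite /w addrAC subrK opprB.
rewrite enormN (le_trans (ler_enormD _ _))// mulrDr lerD ?scheme_normal_le//.
by rewrite enormZ gtr0_norm// ler_pM2l// (f_le _ (scheme_mem k)).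
Qed.

Lemma scheme_dist_le k j : enorm (X (k + j)%N - X k) <= j%:R * h * (M + Mf).
Proof.
elim: j => [|j IH]; first by rewrite addn0 subrr enorm0 !mul0r.
apply: (le_trans (ler_enorm_distD (X (k + j)%N) _ _)).
by have := scheme_step_le (k + j); rewrite addnS -natr1; lra.
Qed.

Lemma scheme_normal k c : C (T k.+1) c ->
  dotr (w k) (c - X k.+1) <=
    h * M / (2 * eta) * enorm (c - X k.+1) ^+ 2.
Proof.
move=> Cc.
have Nw : normal_cone (C (T k.+1)) (X k.+1) (w k).
  by exists 1 => //; rewrite scale1r /w addrC subrK; exact: XS.
have := prox_regular_normal eta_gt0 (@C_prox _) (scheme_mem k.+1) Nw Cc.
move=> /le_trans; apply; rewrite ler_wpM2r ?sqr_ge0//.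
by rewrite ler_wpM2r ?scheme_normal_le// invr_ge0 mulr_ge0// ltW.
Qed.

(** Drift per unit of time of a test vector: [LC] for its endpoint in the moving set, [M + Mf] for
    its base point on the scheme. *)
Let E := LC + M + Mf.

(** The three terms come from the change of the squared distance, from pairing the normal with the
    drift of the test vector, and from the variation of [f]. *)
Definition window_const :=
  M / (2 * eta) * (2 * B * E) + M * E + Lf * (1 + M + Mf) * B.

Lemma scheme_window_step k m j t c : T k <= t < T k + h -> C t c -> (j < m)%N ->
  dotr (X (k + j)%N - X (k + j).+1) (c - X k) - h * dotr (f t (X k)) (c - X k)
  <= h * (M / (2 * eta) * enorm (c - X k) ^+ 2 + window_const * (m%:R * h)).
Proof.
move=> /andP[kt tk] Ctc jm; set th := m%:R * h; set i := (k + j)%N.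
set p := c - X k.
have M0 := M_ge0; have B0 := diam_ge0.
have E0 : 0 <= E by rewrite /E !addr_ge0.
have h0 := ltW h_gt0.
have jth : (j%:R + 1) * h <= th by rewrite ler_wpM2r// natr1 ler_nat.
have jh0 : 0 <= j%:R * h by rewrite mulr_ge0.
have th0 : 0 <= th by rewrite mulr_ge0.
have TiE : T i = T k + j%:R * h by rewrite /T /i natrD; ring.
have TiSE : T i.+1 = T k + (j%:R + 1) * h by rewrite /T /i -natr1 natrD; ring.
(* The discrete normal inequality at step [i] needs a point of [C (T i.+1)], so [c] is replaced by a
   nearby [c']; [e] below collects the error. *)
have [c' Cc' cc'] := C_close (T i.+1) Ctc.
have {}cc' : enorm (c - c') <= LC * th.
  apply: (le_trans cc'); rewrite ler_wpM2l// TiSE ler_norml; lra.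
have XiS : enorm (X i.+1 - X k) <= th * (M + Mf).
  rewrite /i -addnS (le_trans (scheme_dist_le _ _))// -natr1 ler_wpM2r//.
  exact: addr_ge0.
have Xi : enorm (X i - X k) <= th * (M + Mf).
  rewrite (le_trans (scheme_dist_le _ _))// ler_wpM2r ?addr_ge0//; lra.
pose e := (c' - X i.+1) - p.
have eE : enorm e <= E * th.
  have -> : e = - (c - c') - (X i.+1 - X k).
    by rewrite /e /p !opprB addrACA [in RHS]addrACA; congr (_ + _); rewrite addrC.
  rewrite (le_trans (ler_enormB _ _))// enormN /E; lra.
have pB : enorm p <= B by exact: C_diam Ctc (scheme_mem k).
have peB : enorm (c' - X i.+1) <= B by exact: C_diam Cc' (scheme_mem i.+1).
have sq : enorm (c' - X i.+1) ^+ 2 <= enorm p ^+ 2 + 2 * B * E * th.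
  have : enorm (c' - X i.+1) <= enorm p + enorm e.
    by rewrite -[c' - X i.+1](subrK p) addrC; exact: ler_enormD.
  have p0 := enorm_ge0 p; have p1 := enorm_ge0 (c' - X i.+1).
  move=> tri.
  have -> : 2 * B * E * th = (E * th) * (B + B) by ring.
  (* Factor the difference of squares: one factor is at most [E * th], the other at most [2 * B]. *)
  rewrite -lerBlDl subr_sqr.
  have [le|/ltW le] := leP (enorm (c' - X i.+1)) (enorm p).
    apply: (@le_trans _ _ 0); first by rewrite mulr_le0_ge0 ?addr_ge0 ?subr_le0.
    by rewrite mulr_ge0 ?addr_ge0// mulr_ge0.
  by apply: ler_pM; rewrite ?subr_ge0 ?addr_ge0//; lra.
have wp : dotr (w i) p <=
    h * (M / (2 * eta) * (enorm p ^+ 2 + 2 * B * E * th) + M * E * th).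
  have -> : dotr (w i) p = dotr (w i) (c' - X i.+1) - dotr (w i) e.
    by rewrite -dotrBr /e opprB addrC subrK.
  have h1 := scheme_normal Cc'.
  have h2 : h * M / (2 * eta) * enorm (c' - X i.+1) ^+ 2 <=
      h * M / (2 * eta) * (enorm p ^+ 2 + 2 * B * E * th).
    by rewrite ler_wpM2l// divr_ge0 ?mulr_ge0// ltW.
  have h3 := le_trans (ler_norm _) (ler_norm_dotr (- w i) e).
  rewrite dotrNl enormN in h3.
  have h4 : enorm (w i) * enorm e <= h * M * (E * th).
    by apply: ler_pM; rewrite ?enorm_ge0// scheme_normal_le.
  move: h1 h2 h3 h4; rewrite -/i; set k' := (2 * eta)^-1; lra.
have fp : dotr (f (T i) (X i)) p <=
    dotr (f t (X k)) p + Lf * (1 + M + Mf) * B * th.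
  rewrite -lerBlDl -dotrBl (le_trans (dotr_le _ _))//.
  have -> : Lf * (1 + M + Mf) * B * th = (Lf * (1 + M + Mf) * th) * B by ring.
  apply: ler_pM; rewrite ?enorm_ge0//.
  apply: (le_trans (f_lip _ _ _ _)); rewrite -mulrDr -mulrA ler_pM2l//.
  have : `|T i - t| <= th by rewrite TiE ler_norml; lra.
  lra.
have -> : X i - X i.+1 = w i + h *: f (T i) (X i).
  by rewrite /w addrAC subrK.
rewrite dotrDl dotrZl -(ler_pM2l h_gt0) in fp *.
rewrite /window_const; move: wp fp; set k' := (2 * eta)^-1; lra.
Qed.

Lemma scheme_window k m t c : T k <= t < T k + h -> C t c ->
  dotr (X k - X (k + m)%N) (c - X k) - m%:R * h * dotr (f t (X k)) (c - X k)
  <= m%:R * h *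
     (M / (2 * eta) * enorm (c - X k) ^+ 2 + window_const * (m%:R * h)).
Proof.
move=> kt Ctc; set K := _ + window_const * _.
(* The error in [K] is that of the full window, so the same [K] serves all steps and the sum
   telescopes by induction on [j]. *)
suff H j : (j <= m)%N -> dotr (X k - X (k + j)%N) (c - X k)
    - j%:R * h * dotr (f t (X k)) (c - X k) <= j%:R * h * K by exact: H.
elim: j => [_|j IH jm].
  by rewrite addn0 subrr dot0r !mul0r subrr.
have := scheme_window_step kt Ctc jm; rewrite -/K addnS.
have := IH (ltnW jm).
rewrite -natr1 !dotrBl; lra.
Qed.

End scheme.

(** * Passage to the limit along an ultrafilter *)

Section limit.
Local Notation mesh N := (N.+1%:R^-1).
Local Notation node N k := (- N%:R + k%:R * mesh N).
Context {X : nat -> nat -> 'rV[R]_n} (X0 : forall N, C (- N%:R) (X N 0%N))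
  (XS : forall N k, Defs.proj (X N k - mesh N *: f (node N k) (X N k))
    (C (node N k.+1)) (X N k.+1))
  {U : set_system nat} (UU : UltraFilter U) (oo_U : \oo `<=` U)
  {x : R -> 'rV[R]_n}.
(** Number of the last node at or before [t] on the grid starting at [- N%:R]; before that start,
    truncation gives 0. *)
Let index N (t : R) := Num.truncn ((t + N%:R) * N.+1%:R).
Context (x_lim : forall t, (fun N => X N (index N t)) @ U --> x t).

Let UF : ProperFilter U := ultra_proper.

Let mesh_gt0 N : 0 < mesh N :> R. Proof. by rewrite invr_gt0. Qed.

Let index_node N t : - N%:R <= t ->
  node N (index N t) <= t < node N (index N t) + mesh N.
Proof.
move=> Nt; have tN0 : 0 <= t + N%:R by lra.
have := @truncn_itv _ ((t + N%:R) * N.+1%:R).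
rewrite mulr_ge0// => /(_ isT); rewrite -/(index N t) -(natr1 (index N t)) => /andP[h1 h2].
have NN : N.+1%:R * mesh N = 1 :> R by rewrite divff.
have e : (t + N%:R) * N.+1%:R * mesh N = t + N%:R by rewrite -mulrA NN mulr1.
rewrite -(ler_pM2r (mesh_gt0 N)) e in h1.
rewrite -(ltr_pM2r (mesh_gt0 N)) e in h2.
by move: (N.+1%:R^-1 : R) h1 h2 => m h1 h2; lra.
Qed.

Let index_le N s t : s <= t -> (index N s <= index N t)%N.
Proof. by move=> st; apply: le_truncn; rewrite ler_wpM2r// lerD2r. Qed.

Let mesh_cvg0 : (fun N => mesh N : R) @ U --> (0 : R).
Proof. by move=> V V0; apply: oo_U; exact: (@cvg_harmonic R V V0). Qed.

Let near_node_le (t : R) : \forall N \near U, - N%:R <= t.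
Proof. by apply: oo_U; near=> N; rewrite lerNl; near: N; exact: nbhs_infty_ger.
Unshelve. all: by end_near. Qed.

(** Time elapsed on the grid, which is the window length [m%:R * h] of [scheme_window]; it is used
    for [s <= t]. *)
Let gap N s t : R := (index N t - index N s)%:R * mesh N.

Let gap_bound N s t : - N%:R <= s -> s <= t -> `|gap N s t - (t - s)| <= mesh N.
Proof.
move=> Ns st; have /andP[s1 s2] := index_node Ns.
have /andP[t1 t2] := index_node (le_trans Ns st).
rewrite /gap natrB ?index_le// ler_norml.
by move: (N.+1%:R^-1 : R) s1 s2 t1 t2 => m s1 s2 t1 t2; lra.
Qed.

Let gap_cvg s t : s <= t -> (fun N => gap N s t) @ U --> t - s.
Proof.
move=> st; apply/cvgrPdist_le => e e0; near=> N.
rewrite distrC (le_trans (gap_bound _ st))//; near: N.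
  exact: near_node_le.
exact: (@cvgr_le _ _ U _ _ _ mesh_cvg0 e e0).
Unshelve. all: by end_near. Qed.

Lemma limit_lipschitz s t : enorm (x s - x t) <= (M + Mf) * `|s - t|.
Proof.
wlog st : s t / s <= t => [hwlog|].
  by have [st|/ltW ts] := leP s t; [|rewrite enormB distrC]; exact: hwlog.
have h1 : (fun N => enorm (X N (index N s) - X N (index N t))) @ U -->
    enorm (x s - x t).
  by apply: cvg_enorm; apply: cvgB; exact: x_lim.
have h2 : (fun N => gap N s t * (M + Mf)) @ U --> (M + Mf) * `|s - t|.
  rewrite distrC ger0_norm ?subr_ge0// mulrC.
  by apply: cvgM; [exact: gap_cvg|exact: cvg_cst].
apply: ler_cvg_to h1 h2 _; near=> N.
rewrite enormB -[in X in enorm (X - _)](subnKC (index_le N st)).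
exact: (scheme_dist_le (mesh_gt0 N) (X0 N) (XS N)).
Unshelve. all: by end_near. Qed.

(** The approximation at [t] lies in the set of a node within one mesh of [t], hence within
    [LC * mesh N] of a point of [C t]; these points converge to [x t] and [C t] is closed. *)
Lemma limit_mem t : C t (x t).
Proof.
have /choice[c cP] : forall N : nat, exists c, - N%:R <= t ->
    C t c /\ enorm (X N (index N t) - c) <= LC * mesh N.
  (* The value 0 is a placeholder while the grid starts after [t], which stops happening for large
     [N]. *)
  move=> N; have [Nt|nNt] := boolP (- N%:R <= t); last by exists 0.
  have [c Ctc Xc] := C_close t (scheme_mem (X0 N) (XS N) (index N t)).
  exists c => _; split => //; apply: (le_trans Xc); rewrite ler_wpM2l// ler_norml.
  by move: (N.+1%:R^-1 : R) (index_node Nt) => m Ntm; lra.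
have c_lim : c @ U --> x t.
  rewrite -[X in _ --> X]subr0.
  have -> : c = (fun N => X N (index N t) - (X N (index N t) - c N)).
    by apply/funext => N; rewrite subKr.
  apply: cvgB; first exact: x_lim.
  have LC_mesh : (fun N => LC * mesh N) @ U --> (0 : R).
    rewrite -[X in _ --> X](mulr0 LC).
    by apply: cvgM; [exact: cvg_cst|exact: mesh_cvg0].
  apply/cvgrPdist_le => e e0; near=> N.
  rewrite sub0r normrN (le_trans (norm_le_enorm _))//.
  apply: (@le_trans _ _ (LC * mesh N)); last by near: N; exact: (@cvgr_le _ _ U _ _ _ LC_mesh e e0).
  by apply: (cP N _).2; near: N; exact: near_node_le.
apply: (closed_cvg _ (@C_closed t) _ _ c_lim).
by near=> N; apply: (cP N _).1; near: N; exact: near_node_le.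
Unshelve. all: by end_near. Qed.

Lemma limit_window t d c : 0 <= d -> C t c ->
  dotr (x t - x (t + d)) (c - x t) - d * dotr (f t (x t)) (c - x t) <=
  d * (M / (2 * eta) * enorm (c - x t) ^+ 2 + window_const * d).
Proof.
move=> d0 Ctc; have td : t <= t + d by rewrite lerDl.
have gapd : (fun N => gap N t (t + d)) @ U --> d.
  by have := gap_cvg td; have -> : t + d - t = d by rewrite addrC addKr.
pose y N := X N (index N t).
have cy : (fun N => c - y N) @ U --> c - x t.
  by apply: cvgB; [exact: cvg_cst|exact: x_lim].
have fy : (fun N => f t (y N)) @ U --> f t (x t).
  apply/cvgrPdist_le => e e0.
  have : (fun N => Lf * enorm (x t - y N)) @ U --> Lf * enorm (x t - x t).
    apply: cvgM; first exact: cvg_cst.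
    by apply: cvg_enorm; apply: cvgB; [exact: cvg_cst|exact: x_lim].
  rewrite subrr enorm0 mulr0 => /cvgr_le /(_ e e0); apply: filterS => N.
  apply: le_trans; rewrite (le_trans (norm_le_enorm _))//.
  by rewrite (le_trans (f_lip _ _ _ _))// subrr normr0 mulr0 add0r.
have lhs : (fun N => dotr (y N - X N (index N (t + d))) (c - y N)
      - gap N t (t + d) * dotr (f t (y N)) (c - y N)) @ U -->
    dotr (x t - x (t + d)) (c - x t) - d * dotr (f t (x t)) (c - x t).
  apply: cvgB; first by apply: cvg_dotr cy; apply: cvgB; exact: x_lim.
  by apply: cvgM => //; exact: cvg_dotr.
have rhs : (fun N => gap N t (t + d) * (M / (2 * eta) * enorm (c - y N) ^+ 2
      + window_const * gap N t (t + d))) @ U -->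
    d * (M / (2 * eta) * enorm (c - x t) ^+ 2 + window_const * d).
  apply: cvgM => //; apply: cvgD; last by apply: cvgM => //; exact: cvg_cst.
  apply: cvgM; first exact: cvg_cst.
  rewrite expr2; under eq_fun do rewrite expr2.
  by apply: cvgM; exact: cvg_enorm.
apply: ler_cvg_to lhs rhs _; near=> N.
have Nt : - N%:R <= t by near: N; exact: near_node_le.
have := scheme_window (mesh_gt0 N) (X0 N) (XS N)
  (index N (t + d) - index N t) (index_node Nt) Ctc.
by rewrite subnKC ?index_le.
Unshelve. all: by end_near. Qed.

Lemma limit_normal t : derivable x t 1 ->
  normal_cone (C t) (x t) (- 'D_1 x t - f t (x t)).
Proof.
move=> dx; apply: (@normal_coneI _ _ (M / (2 * eta))) => [|c Ctc].
  exact: limit_mem.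
pose q (h : R) := h^-1 *: (x (h + t) - x t).
have qE : q = fun h => h^-1 *: (x (h *: 1 + t) - x t).
  by apply/funext => h; rewrite /q [_ *: 1]mulr1.
have qD : q @ 0^'+ --> 'D_1 x t.
  by rewrite qE; exact: (cvg_dnbhs_at_right dx).
have lhs : (fun h => dotr (- q h - f t (x t)) (c - x t)) @ 0^'+ -->
    dotr (- 'D_1 x t - f t (x t)) (c - x t).
  apply: cvg_dotr; last exact: cvg_cst.
  by apply: cvgB; [exact: cvgN|exact: cvg_cst].
have rhs : (fun h : R => M / (2 * eta) * enorm (c - x t) ^+ 2 + window_const * h)
    @ 0^'+ --> M / (2 * eta) * enorm (c - x t) ^+ 2.
  rewrite -[X in _ --> X]addr0; apply: cvgD; first exact: cvg_cst.
  rewrite -[X in _ --> X](mulr0 window_const); apply: cvgM; first exact: cvg_cst.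
  by apply: cvg_at_right_filter; exact: cvg_id.
apply: ler_cvg_to lhs rhs _; near=> h.
have h0 : 0 < h by near: h; exact: nbhs_right_gt.
(* After division by [h] the window inequality bounds the quotient up to [window_const * h], which
   vanishes as [h] decreases to 0. *)
rewrite -(ler_pM2l h0) (le_trans _ (limit_window (ltW h0) Ctc))//.
have -> : x t - x (t + h) = - (h *: q h).
  by rewrite /q scalerA divff ?gt_eqF// scale1r opprB (addrC t).
by rewrite dotrBl !dotrNl (dotrZl h (q h)); lra.
Unshelve. all: by end_near. Qed.

End limit.

(** * Existence on the whole line *)

Lemma sweeping_exists : exists x, sweeping_solution C f `]-oo, +oo[ x.
Proof.
have /choice[X XP] : forall N : nat, exists X : nat -> 'rV[R]_n,
    C (- N%:R) (X 0%N) /\ forall k,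
    Defs.proj (X k - N.+1%:R^-1 *: f (- N%:R + k%:R * N.+1%:R^-1) (X k))
      (C (- N%:R + k.+1%:R * N.+1%:R^-1)) (X k.+1).
  by move=> N; exact: catching_up.
have X0 N : C (- N%:R) (X N 0%N) by have [] := XP N.
have XS N k := (XP N).2 k.
have [c0 C0c0] := C_nonempty 0.
have [U [UU oo_U]] := ultraFilterLemma (@eventually_filter).
have /choice[x x_lim] : forall t : R, exists l : 'rV[R]_n,
    (fun N => X N (Num.truncn ((t + N%:R) * N.+1%:R))) @ U --> l.
  (* All approximations stay in one ball of radius [B] around [c0], so the same ultrafilter gives a
     limit at every time. *)
  move=> t; apply: (ultra_cvg_compact UU (@compact_enorm_ball _ _ c0 B)) => N /=.
  exact: C_diam C0c0 (scheme_mem (X0 N) (XS N) _).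
have V0 : 0 <= M + Mf by rewrite addr_ge0// M_ge0.
have x_lip := limit_lipschitz X0 XS UU oo_U x_lim.
exists x; split.
- by move=> a b _ _; exact: lipschitz_abs_continuous x_lip.
- by move=> t _; exact: (limit_mem X0 XS UU oo_U x_lim).
- apply: (@filterS _ _ (ae_filter_ringOfSetsType mu) _ _ _
    (lipschitz_ae_derivable_rV x_lip)) => t /= dx _; split => //.
  exists (- 'D_1 x t - f t (x t)); last by rewrite subrK.
  exact: (limit_normal X0 XS UU oo_U x_lim).
Qed.

End sweeping.

Theorem theorem2 (R : realType) (n : nat) (hn : (1 <= n)%N)
  (eta : R) (eta_gt0 : 0 < eta)
  (C : R -> set 'rV[R]_n)
  (C_nonempty : forall t, C t !=set0)
  (C_closed : forall t, closed (C t))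
  (C_prox : forall t, prox_regular eta (C t))
  (LC : R) (LC_ge0 : 0 <= LC)
  (C_lip : forall t1 t2 : R,
     (hausdorff_dist (C t1) (C t2) <= (LC * `|t1 - t2|)%:E)%E)
  (f : R -> 'rV[R]_n -> 'rV[R]_n)
  (Lf : R) (Lf_gt0 : 0 < Lf)
  (f_lip : forall (t1 t2 : R) (x1 x2 : 'rV[R]_n),
     enorm (f t1 x1 - f t2 x2) <= Lf * `|t1 - t2| + Lf * enorm (x1 - x2))
  (Mf : R) (Mf_ge0 : 0 <= Mf)
  (f_bound : forall (t : R) (x : 'rV[R]_n),
     (\bigcup_(s in setT) C s) x -> enorm (f t x) <= Mf)
  (alpha : R) (alpha_gt0 : 0 < alpha)
  (f_mono : forall (t : R) (x1 x2 : 'rV[R]_n),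
     alpha * enorm (x1 - x2) ^+ 2 <= dotr (f t x1 - f t x2) (x1 - x2))
  (alpha_big : (LC + Mf) / eta < alpha) :
  exists x0 : R -> 'rV[R]_n,
    unique (sweeping_solution C f `]-oo, +oo[) x0
    /\ globally_exp_stable C f x0.
Proof.
have [x0 x0_sol] : exists x0, sweeping_solution C f `]-oo, +oo[ x0.
  exact: (sweeping_exists eta_gt0 C_nonempty C_closed C_prox LC_ge0 C_lip Lf_gt0
    f_lip Mf_ge0 f_bound alpha_gt0 f_mono).
exists x0; split; first split=> //.
  move=> x x_sol.
  exact: (sweeping_unique eta_gt0 C_nonempty C_closed C_prox LC_ge0 C_lip
    Mf_ge0 f_bound alpha_gt0 f_mono alpha_big).
exists 1, (alpha - (LC + Mf) / eta); split; rewrite ?subr_gt0//.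
move=> tau x x_sol t taut; rewrite mul1r.
apply: (sweeping_contraction eta_gt0 C_nonempty C_closed C_prox LC_ge0 C_lip
  Mf_ge0 f_bound alpha_gt0 f_mono alpha_big taut _ x_sol).
  by move=> s /=; rewrite !in_itv/= => /andP[->].
(* The contraction compares solutions on a common interval, so [x0] is restricted to the half-line
   from [tau]. *)
have [ac0 C0 ae0] := x0_sol; split => [a b ab _|s _|].
- exact: ac0.
- exact: C0.
- apply: (@filterS _ _ (ae_filter_ringOfSetsType (@lebesgue_measure R)) _ _ _ ae0).
  by move=> s /= h _; exact: h.
Qed.
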